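(* Let $\psi$ be a first-order logic sentence over a signature containing a binary predicate symbol $edge$ (and possibly further auxiliary symbols), such that every finite tree $T=(V,E)$ corresponds to some model $\mathcal{I}$ of $\psi$, i.e., for every finite tree $(V,E)$ there is a model $\mathcal{I}$ of $\psi$ with $(V,E) \cong (\Delta^{\mathcal{I}}, edge^{\mathcal{I}})$ as directed graphs. Then $\psi$ also has a model $\mathcal{J}$ which does not correspond to any (finite or infinite) tree, i.e., there is no tree $(V,E)$, finite or infinite, with $(V,E)\cong(\Delta^{\mathcal{J}}, edge^{\mathcal{J}})$.
   Context: A tree (rooted directed branching tree) is a directed graph $T=(V,E)$, where $V$ is a set of nodes and $E\subseteq V\times V$ is the set of edges, such that: (1) there is exactly one node $r\in V$, called the root, which has no incoming edges, i.e., $E\cap (V\times\{r\})=\emptyset$; (2) every node $v\in V\setminus\{r\}$ has exactly one incoming edge, i.e., there exists exactly one $v'\in V$ with $(v',v)\in E$; (3) every node $v\in V$ can be reached from the root by traversing edges, i.e., there are a number $n\ge 0$ and a sequence $v_0,\ldots,v_n$ of nodes with $v_0=r$, $v_n=v$, and $(v_i,v_{i+1})\in E$ for all $i\in\{0,\ldots,n-1\}$. A tree is finite if $V$ is finite. For a first-order interpretation (structure) $\mathcal{I}$, $\Delta^{\mathcal{I}}$ denotes its domain and $edge^{\mathcal{I}}\subseteq \Delta^{\mathcal{I}}\times\Delta^{\mathcal{I}}$ the interpretation of the predicate $edge$. The interpretation $\mathcal{I}$ corresponds to a tree $(V,E)$ if $(V,E)$ and $(\Delta^{\mathcal{I}},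 edge^{\mathcal{I}})$ are isomorphic as directed graphs; the interpretations of any other symbols are ignored. *)

(* Defs.v *)
(* MathComp world *)
From mathcomp Require Import all_boot.
From mathcomp Require Import classical_sets cardinality.

Set Implicit Arguments.
Unset Strict Implicit.
Unset Printing Implicit Defensive.

(* Constants are the function symbols of arity 0. *)
Record signature : Type := Signature {
  fsym : Type;
  psym : Type;
  fun_arity : fsym -> nat;
  pred_arity : psym -> nat
}.

(* Well-scoped de Bruijn syntax: [term S n] and [formula S n] have their free
   variables among the [n] variables ['I_n]; a quantifier binds variable 0 and
   shifts the other ones by one.  Arguments of symbols of arity [k] are
   k-tuples, given as finite functions on ['I_k]. *)
Inductive term (S : signature) (n : nat) : Type :=
| Var (i : 'I_n)
| App (f : fsym S) (ts : {ffun 'I_(fun_arity f) -> term S n}).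

(* Negation is implication of [Bot]. *)
Inductive formula (S : signature) : nat -> Type :=
| Bot n : formula S n
| Eq n (t u : term S n) : formula S n
| Rel n (p : psym S) (ts : {ffun 'I_(pred_arity p) -> term S n}) : formula S n
| And n (phi chi : formula S n) : formula S n
| Or n (phi chi : formula S n) : formula S n
| Imp n (phi chi : formula S n) : formula S n
| All n (phi : formula S n.+1) : formula S n
| Ex n (phi : formula S n.+1) : formula S n.

Definition sentence (S : signature) : Type := formula S 0.

Record structure (S : signature) : Type := Structure {
  dom : Type;
  dom_nonempty : inhabited dom;
  fint : forall f : fsym S, {ffun 'I_(fun_arity f) -> dom} -> dom;
  pint : forall p : psym S, {ffun 'I_(pred_arity p) -> dom} -> Prop
}.

Fixpoint eval (S : signature) (I : structure S) (n : nat)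
    (rho : {ffun 'I_n -> dom I}) (t : term S n) : dom I :=
  match t with
  | Var i => rho i
  | App f ts => fint [ffun i => eval rho (ts i)]
  end.

Definition extend (D : Type) (n : nat) (x : D) (rho : {ffun 'I_n -> D}) :
    {ffun 'I_n.+1 -> D} :=
  [ffun i => if unlift ord0 i is Some j then rho j else x].

Fixpoint sat (S : signature) (I : structure S) (n : nat) (phi : formula S n) :
    {ffun 'I_n -> dom I} -> Prop :=
  match phi in formula _ n return {ffun 'I_n -> dom I} -> Prop with
  | Bot _ => fun _ => False
  | Eq _ t u => fun rho => eval rho t = eval rho u
  | Rel _ _ ts => fun rho => pint [ffun i => eval rho (ts i)]
  | And _ phi chi => fun rho => sat phi rho /\ sat chi rho
  | Or _ phi chi => fun rho => sat phi rho \/ sat chi rho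
  | Imp _ phi chi => fun rho => sat phi rho -> sat chi rho
  | All _ phi => fun rho => forall x, sat phi (extend x rho)
  | Ex _ phi => fun rho => exists x, sat phi (extend x rho)
  end.

Definition models (S : signature) (I : structure S) (psi : sentence S) : Prop :=
  sat psi (ffun0 (rT := fun _ => dom I) (card_ord 0)).

(* The binary relation interpreting [p]; meaningful when [pred_arity p = 2]. *)
Definition binrel (S : signature) (I : structure S) (p : psym S)
    (x y : dom I) : Prop :=
  pint (p := p) [ffun i : 'I_(pred_arity p) => nth x [:: x; y] i].

Definition is_tree (V : Type) (E : V -> V -> Prop) : Prop :=
  exists r : V,
    [/\ unique (fun r' => forall u, ~ E u r') r,
        forall v, v <> r -> exists! u, E u v
      & forall v, exists (n : nat) (p : nat -> V),
          [/\ p 0 = r, p n = v & forall i, i < n -> E (p i) (p i.+1)]].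

Definition digraph_iso (V W : Type) (E : V -> V -> Prop) (F : W -> W -> Prop) :
    Prop :=
  exists f : V -> W, bijective f /\ forall u v, E u v <-> F (f u) (f v).

Definition corresponds (S : signature) (edge : psym S) (I : structure S)
    (V : Type) (E : V -> V -> Prop) : Prop :=
  digraph_iso E (@binrel S I edge).

(* Main.v *)
Require Import Defs.
From mathcomp Require Import all_boot.
From mathcomp Require Import boolp filter.
From mathcomp Require Import classical_sets cardinality.

Set Implicit Arguments.
Unset Strict Implicit.
Unset Printing Implicit Defensive.

Local Open Scope classical_set_scope.

(** The path with [n] edges is a finite tree, hence corresponds to a model [I n]
    of [psi].  By Los's theorem, the ultraproduct of the [I n] modulo a
    nonprincipal ultrafilter is a model of [psi].  The class of the sequence of
    the leaves is not reachable from any root: on a path of length [m] ending in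
    it, the first node has depth [n - m] in [I n], hence a predecessor as soon
    as [n > m]. *)

(** The factors of the ultraproduct have different domains, so a sequence of elements is a dependent
    function. *)
Lemma dependent_fun_choice K (D : K -> Type) (P : forall k, D k -> Prop) :
  (forall k, exists x, P k x) -> exists f : forall k, D k, forall k, P k (f k).
Proof. by move=> Px; exists (fun k => projT1 (cid (Px k))) => k; case: cid. Qed.

(* The generated [term_ind] has no induction hypothesis for the arguments of
   [App], which are nested in a [{ffun _}]. *)
Lemma term_ffun_ind (S : signature) n (P : term S n -> Prop) :
  (forall i, P (Var S i)) ->
  (forall f (ts : {ffun 'I_(fun_arity f) -> term S n}),
    (forall i, P (ts i)) -> P (App ts)) ->
  forall t, P t.
Proof. by move=> PVar PApp; fix IH 1 => -[i|f ts]; [exact: PVar|apply: PApp => i]. Qed.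

Section Ultraproduct.
Context (S : signature) (K : Type) (U : set_system K) {UU : UltraFilter U}.
Variable I : K -> structure S.

Let eqU (x : forall k, dom (I k)) : set (forall k, dom (I k)) :=
  [set y | U [set k | x k = y k]].

(** The quotient by equality [U]-almost everywhere, encoded as the type of its equivalence classes.
    Symbols are interpreted on the chosen representatives [ultrarep], so no compatibility with the
    equivalence has to be checked. *)
Definition ultradom : Type :=
  {C : set (forall k, dom (I k)) | exists x, C = eqU x}.

Definition ultraclass (x : forall k, dom (I k)) : ultradom :=
  exist _ (eqU x) (ex_intro _ x erefl).

Definition ultrarep (q : ultradom) : forall k, dom (I k) :=
  projT1 (cid (proj2_sig q)).

Lemma ultra_forall (J : finType) (A : J -> set K) :
  (forall j, U (A j)) -> U [set k | forall j, A j k].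
Proof. exact: filter_forall. Qed.

Lemma ultraclassK x : U [set k | ultrarep (ultraclass x) k = x k].
Proof.
rewrite /ultrarep; case: cid => y /= xy.
suff: eqU y x by [].
by rewrite -xy; apply: filterE.
Qed.

Lemma ultradom_eq (q q' : ultradom) :
  q = q' <-> U [set k | ultrarep q k = ultrarep q' k].
Proof.
split=> [->|]; first exact: filterE.
rewrite /ultrarep; case: cid => x /= qx; case: cid => y /= q'y xy.
apply: eq_sig_hprop => [C ? ?|]; [exact: Prop_irrelevance|rewrite qx q'y].
apply/seteqP; split=> z /= Uz; apply: filterS2 xy Uz => k /=; congruence.
Qed.

Lemma ultradom_inhabited : inhabited ultradom.
Proof.
have dI k : exists x : dom (I k), True by case: (dom_nonempty (I k)) => x; exists x.
by have [x _] := dependent_fun_choice dI; constructor; exact: ultraclass x.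
Qed.

Definition ultraproduct : structure S := {|
  dom := ultradom;
  dom_nonempty := ultradom_inhabited;
  fint f ts := ultraclass (fun k => fint [ffun i => ultrarep (ts i) k]);
  pint p ts := U [set k | pint (p := p) [ffun i => ultrarep (ts i) k]]
|}.

Lemma ultraproduct_fint f (ts : {ffun 'I_(fun_arity f) -> dom ultraproduct}) :
  U [set k | ultrarep (fint ts) k = fint [ffun i => ultrarep (ts i) k]].
Proof. exact: ultraclassK. Qed.

Definition ultraval n (rho : {ffun 'I_n -> dom ultraproduct}) k :
  {ffun 'I_n -> dom (I k)} := [ffun i => ultrarep (rho i) k].

Lemma ultraval_extend n q (rho : {ffun 'I_n -> dom ultraproduct}) k :
  ultraval (extend q rho) k = extend (ultrarep q k) (ultraval rho k).
Proof. by apply/ffunP => i; rewrite !ffunE; case: unliftP => [j|] _; rewrite ?ffunE. Qed.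

Lemma ultraproduct_ex (P : forall k, dom (I k) -> Prop) :
  (exists q : dom ultraproduct, U [set k | P k (ultrarep q k)]) <->
  U [set k | exists x, P k x].
Proof.
split=> [[q]|UP]; first by apply: filterS => k Pk; exists (ultrarep q k).
(* A witness where there is one, an arbitrary element of the nonempty domain elsewhere. *)
have Px k : exists x, (exists y, P k y) -> P k x.
  case: (pselect (exists y, P k y)) => [[x Pkx]|nP]; first by exists x.
  by case: (dom_nonempty (I k)) => x; exists x.
have [x xP] := dependent_fun_choice Px.
by exists (ultraclass x); apply: filterS2 UP (ultraclassK x) => k /= Pk ->; exact: xP.
Qed.

(** Otherwise, by maximality of [U], counterexamples exist in [U]-almost all factors; they assemble
    into a class [q] that violates the hypothesis. *)
Lemma ultraproduct_all (P : forall k, dom (I k) -> Prop) :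
  (forall q : dom ultraproduct, U [set k | P k (ultrarep q k)]) <->
  U [set k | forall x, P k x].
Proof.
split=> [UP|UP q]; last by apply: filterS UP => k; apply.
have [//|/filterS] := in_ultra_setVsetC [set k | forall x, P k x] UU.
move=> /(_ [set k | exists x, ~ P k x]) /(_ (fun k => (existsNP _).2)).
move=> /ultraproduct_ex[q Unq].
have : U ([set k | P k (ultrarep q k)] `&` [set k | ~ P k (ultrarep q k)]).
  exact: filterI.
by move=> /filter_ex[k []].
Qed.

Lemma ultraproduct_eval n (rho : {ffun 'I_n -> dom ultraproduct}) (t : term S n) :
  U [set k | ultrarep (eval rho t) k = eval (ultraval rho k) t].
Proof.
elim/term_ffun_ind: t => [i|f ts IH] /=.
  by apply: filterE => k; rewrite /= ffunE.
have Uts := ultra_forall IH.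
have Uf := ultraproduct_fint [ffun i => eval rho (ts i)].
apply: filterS2 Uts Uf => k /= ts_k ->.
by congr fint; apply/ffunP => i; rewrite !ffunE -ts_k.
Qed.

(** Induction on [phi]: [Bot] uses that [U] is proper, [Ex] uses choice, and maximality of [U]
    enters in [Or], [Imp] and [All]. *)
Theorem Los n (phi : formula S n) (rho : {ffun 'I_n -> dom ultraproduct}) :
  sat phi rho <-> U [set k | sat phi (ultraval rho k)].
Proof.
elim: phi rho => {n} [n|n t u|n p ts|n phi IH chi IH'|n phi IH chi IH'
                     |n phi IH chi IH'|n phi IH|n phi IH] rho /=.
- by split=> // /filter_ex[].
- rewrite ultradom_eq.
  have Ut := ultraproduct_eval rho t; have Uu := ultraproduct_eval rho u.
  by split; apply: filterS3 Ut Uu => k /= -> ->.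
- have Uts := ultra_forall (fun i => ultraproduct_eval rho (ts i)).
  split; apply: filterS2 Uts => k /= ts_k; congr pint;
    by apply/ffunP => i; rewrite !ffunE ts_k.
- rewrite IH IH'; split=> [[]|UA]; first exact: filterI.
  by split; apply: filterS UA => k [].
- rewrite IH IH'; split=> [[]|]; first by apply: filterS => k ?; left.
    by apply: filterS => k ?; right.
  have [|Un] := in_ultra_setVsetC [set k | sat phi (ultraval rho k)] UU; first by left.
  by move=> UA; right; apply: filterS2 Un UA => k ? [].
- rewrite IH IH'; split=> [Uimp|Uimp Uphi]; last by apply: filterS2 Uimp Uphi => k; apply.
  have [/Uimp|] := in_ultra_setVsetC [set k | sat phi (ultraval rho k)] UU.
    by apply: filterS => k /=.
  by apply: filterS => k nphi /nphi.
- rewrite -ultraproduct_all; split=> + q => /(_ q); rewrite IH;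
    by apply: filterS => k /=; rewrite ultraval_extend.
- rewrite -ultraproduct_ex; split=> -[q]; rewrite ?IH => Uq; exists q; rewrite ?IH;
    by apply: filterS Uq => k /=; rewrite ultraval_extend.
Qed.

Lemma ultraproduct_models (psi : sentence S) :
  (forall k, models (I k) psi) -> models ultraproduct psi.
Proof.
move=> Ipsi; apply/Los/filterE => k /=.
rewrite (_ : ultraval _ _ = ffun0 (rT := fun _ => dom (I k)) (card_ord 0)).
  exact: Ipsi.
by apply/ffunP => -[].
Qed.

Lemma ultraproduct_binrel (p : psym S) (x y : dom ultraproduct) :
  binrel p x y <-> U [set k | binrel p (ultrarep x k) (ultrarep y k)].
Proof.
have xyE k : [ffun i : 'I_(pred_arity p) =>
      ultrarep ([ffun i : 'I_(pred_arity p) => nth x [:: x; y] i] i) k] =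
    [ffun i : 'I_(pred_arity p) => nth (ultrarep x k) [:: ultrarep x k; ultrarep y k] i].
  (* At an index above 1, both sides are the default value [ultrarep x k]. *)
  by apply/ffunP => -[[|[|i]] ilt]; rewrite !ffunE //= !nth_nil.
by rewrite /binrel /=; split; apply: filterS => k /=; rewrite xyE.
Qed.

End Ultraproduct.

Definition path_edge n (i j : 'I_n.+1) : Prop := j = i.+1 :> nat.

Lemma path_edge_tree n : is_tree (@path_edge n).
Proof.
exists ord0; split.
- split=> [u|j]; first by [].
  case: j => -[|j] jn nj; first exact: val_inj.
  by case: (nj (Ordinal (ltnW jn))).
- case=> -[|j] jn nj; first by case: nj; exact: val_inj.
  exists (Ordinal (ltnW jn)); split=> // i; rewrite /path_edge /= => -[ji].
  exact: val_inj.
(* The path 0, 1, ..., [v]; [inord] is the identity on these values, which are at most [n]. *)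
- move=> v; exists v, inord; split=> [|| i iv].
  + by apply: val_inj; rewrite /= inordK.
  + exact: inord_val.
  + have vn := ltn_ord v.
    by rewrite /path_edge !inordK // ?(leq_trans iv (ltnW vn)) ?(leq_ltn_trans iv vn).
Qed.

Lemma path_edge_depth n m (p : nat -> 'I_n.+1) :
  (forall i, i < m -> path_edge (p i) (p i.+1)) -> p m = p 0 + m :> nat.
Proof.
elim: m => [|m IH] pE; first by rewrite addn0.
by rewrite (pE m) // IH ?addnS // => i im; apply: pE; exact: ltnW.
Qed.

Lemma path_edge_pred n m (p : nat -> 'I_n.+1) : m < n ->
  (forall i, i < m -> path_edge (p i) (p i.+1)) -> p m = ord_max ->
  exists i, path_edge i (p 0).
Proof.
move=> mn /path_edge_depth pm pmax.
have : 0 < p 0 by rewrite -(ltn_add2r m) -pm pmax.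
case: (p 0) => -[//|j] jn _.
by exists (Ordinal (ltnW jn)).
Qed.

Theorem proposition1 (S : signature) (edge : psym S)
    (edge_binary : pred_arity edge = 2) (psi : sentence S)
    (finite_trees_correspond :
      forall (V : Type) (E : V -> V -> Prop),
        is_tree E -> finite_set [set: V] ->
        exists I : structure S, models I psi /\ corresponds edge I E) :
  exists J : structure S,
    models J psi /\
    ~ exists (V : Type) (E : V -> V -> Prop),
        is_tree E /\ corresponds edge J E.
Proof.
have pathI n := finite_trees_correspond _ _ (@path_edge_tree n) finite_finset.
have [I Ipath] := choice pathI.
(* [U] contains all final segments of the natural numbers, so any fixed [m] is below [U]-almost all
   [n]. *)
have [U [UU oo_U]] := ultraFilterLemma eventually_filter.
(* The leaf is chosen before [m]: one sequence of leaves must serve for paths of every length. *)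
have leafI n : exists l : dom (I n), forall m p, m < n ->
    (forall i, i < m -> binrel edge (p i) (p i.+1)) -> p m = l ->
    exists x, binrel edge x (p 0).
  have [_ [g [[h gK hK] gE]]] := Ipath n.
  exists (g ord_max) => m p mn pE pm.
  have [||i iE] := @path_edge_pred n m (h \o p) mn.
  - by move=> i im; apply/gE; rewrite /= !hK; exact: pE.
  - by rewrite /= pm gK.
  - by exists (g i); rewrite -[p 0]hK; apply/gE.
have [leaf leafP] := dependent_fun_choice leafI.
exists (ultraproduct U I); split.
  by apply: ultraproduct_models => n; case: (Ipath n).
move=> [V [E [[r [[r_root _] _ reach]] [f [[g fK gK] fE]]]]].
have [m [p [p0 pm pE]]] := reach (g (ultraclass U leaf)).
(* The length [m] does not depend on [n], so this is a finite intersection of sets of [U]. *)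
have Upath : U [set n | forall i : 'I_m,
    binrel edge (ultrarep (f (p i)) n) (ultrarep (f (p i.+1)) n)].
  by apply: ultra_forall => i; apply/ultraproduct_binrel/fE/pE.
have Um : U [set n | m < n] by apply: oo_U; exists m.+1.
have Uleaf : U [set n | ultrarep (f (p m)) n = leaf n].
  by rewrite pm gK; exact: ultraclassK.
have : U [set n | exists x, binrel edge x (ultrarep (f (p 0)) n)].
  apply: filterS3 Upath Um Uleaf => n /= npath mn nleaf.
  apply: (leafP n m (fun i => ultrarep (f (p i)) n)) => // i im.
  exact: npath (Ordinal im).
(* The predecessors found in the factors assemble into a class [q], and [g q] is then a predecessor
   of the root [r]. *)
move=> /(@ultraproduct_ex _ _ _ _ _ (fun n x => binrel edge x _))[q].
by rewrite -ultraproduct_binrel -[q]gK p0 -fE => /r_root.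
Qed.
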